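(* Let $p \in [1,\infty]$ with $p \neq 2$ and let $n\geq 2$ be an integer. Then $\operatorname{Aut}(\mathcal{L}_p^{n+1}) = \operatorname{Aut}(\mathcal{L}_1^{n+1})$. In particular, any $A \in \operatorname{Aut}(\mathcal{L}_p^{n+1})$ can be written as $$A=\alpha\begin{pmatrix}1 & 0\\ 0 & P\end{pmatrix},$$ where $\alpha > 0$ and $P$ is an $n\times n$ generalized permutation matrix.
   Context: For $p\in[1,\infty]$ the $p$-cone is $\mathcal{L}_p^{n+1} = \{(t,x)\in\mathbb{R}\times\mathbb{R}^n \mid t\geq \|x\|_p\}\subseteq\mathbb{R}^{n+1}$, where $\|x\|_p=(|x_1|^p+\cdots+|x_n|^p)^{1/p}$ for $p\in[1,\infty)$ and $\|x\|_\infty=\max(|x_1|,\ldots,|x_n|)$. For a convex cone $\mathcal{K}\subseteq\mathbb{R}^m$, $\operatorname{Aut}(\mathcal{K})=\{A\in GL_m(\mathbb{R})\mid A\mathcal{K}=\mathcal{K}\}$. A generalized permutation matrix is a permutation matrix multiplied by a diagonal matrix whose diagonal entries are $\pm1$. *)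

(* Defs.v *)
From mathcomp Require Import all_boot all_order all_algebra all_fingroup.
From mathcomp Require Import all_classical all_reals all_analysis.
Set Implicit Arguments.
Unset Strict Implicit.
Unset Printing Implicit Defensive.
Import Order.TTheory GRing.Theory Num.Theory.
Import numFieldNormedType.Exports.

Local Open Scope classical_set_scope.
Local Open Scope ring_scope.

(* Only meant for 1 <= p <= +oo; the value at p = -oo is junk. *)
Definition pnorm (R : realType) (p : \bar R) (n : nat) (x : 'cV[R]_n) : R :=
  match p with
  | r%:E => (\sum_(i < n) `|x i ord0| `^ r) `^ r^-1
  | +oo%E => \big[Num.max/0]_(i < n) `|x i ord0|
  | -oo%E => 0
  end.

(* A point (t, x) of R x R^n is the column vector with upper block t and
   lower block x. *)
Definition pcone (R : realType) (p : \bar R) (n : nat) : set 'cV[R]_(1 + n) :=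
  [set v | pnorm p (dsubmx v) <= usubmx v ord0 ord0].
Arguments pcone {R} p n _.

Definition cone_aut (R : realType) (m : nat) (K : set 'cV[R]_m) :
    set 'M[R]_m :=
  [set A | A \in unitmx /\ [set A *m v | v in K] = K].

Definition gen_perm_mx (R : realType) (n : nat) (P : 'M[R]_n) : Prop :=
  exists (Q : 'M[R]_n) (d : 'rV[R]_n),
    [/\ is_perm_mx Q,
        (forall i, d ord0 i = 1 \/ d ord0 i = -1)
      & P = Q *m diag_mx d].

(* Main.v *)
Require Import Defs.
From mathcomp Require Import all_boot all_order all_algebra all_fingroup.
From mathcomp Require Import all_classical all_reals all_analysis.
From mathcomp Require Import ring lra.
Import Order.TTheory GRing.Theory Num.Theory.
Import numFieldNormedType.Exports.
Local Open Scope classical_set_scope.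
Local Open Scope ring_scope.

(** Let [1 <= p < 2]. The rays through the points [(1, +-e_i)] are the only
    rays [v] of the cone such that the boundary at [v] is smooth to second order
    in no direction but [v] itself: along another direction the norm picks up a
    term of order [e^p], which is not [O(e^2)]. An automorphism [A] therefore
    permutes these [2n] rays. Since [(1, e_i) + (1, -e_i) = (2, 0)] for every
    [i], a nonzero component of [A (2, 0)] along [e_m] would force, for every
    [i], one of [A (1, +-e_i)] to lie on one and the same ray, contradicting
    injectivity; so [A (1, 0)] is a multiple of [(1, 0)] and [A] has the stated
    form. For [2 < p <= +oo] the same is applied to the transpose of [A], which
    is an automorphism of the dual cone, the [q]-cone with [1 <= q < 2]. *)

(** * Bernoulli-type inequalities for real powers *)

Section Bernoulli.
Context {R : realType}.
Implicit Types (r h t : R).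

(** Young's inequality for the product of (1 + h)^r and 1, with exponents 1/r and 1/(1 - r); the
    endpoints 0 and 1 of [r] are treated apart because one exponent degenerates there. *)
Lemma powR_le_tangent r h : 0 <= r -> r <= 1 -> -1 <= h ->
  (1 + h) `^ r <= 1 + r * h.
Proof.
move=> r0 r1 h1; have h0 : 0 <= 1 + h by lra.
case: (eqVneq r 0) => [->|rn0]; first by rewrite powRr0; lra.
case: (eqVneq r 1) => [->|rn1]; first by rewrite powRr1//; lra.
have rp : 0 < r by rewrite lt_def rn0.
have rp' : 0 < 1 - r by rewrite subr_gt0 lt_def eq_sym rn1.
have := @conjugate_powR _ ((1 + h) `^ r) 1 r^-1 (1 - r)^-1 (powR_ge0 _ _)
  ler01.
rewrite !invr_gt0 !invrK powR1 mulr1 mul1r -powRrM divff// powRr1// => H.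
by apply: le_trans (H _ _ _) _ => //; lra.
Qed.

(** The concave case for the exponent 1/r and the increment [r * h], raised to the power [r]. *)
Lemma powR_ge_tangent r h : 1 <= r -> -1 <= h -> 0 <= 1 + r * h ->
  1 + r * h <= (1 + h) `^ r.
Proof.
move=> r1 h1 rh0; have r0 : 0 < r by lra.
have h0 : 0 <= 1 + h by lra.
have ri : 0 <= r^-1 by rewrite invr_ge0 ltW.
have H : (1 + r * h) `^ r^-1 <= 1 + h.
  have -> : 1 + h = 1 + r^-1 * (r * h) by field; lra.
  apply: powR_le_tangent => //; first by rewrite invf_le1.
  by lra.
have := ge0_ler_powR (ltW r0) (powR_ge0 _ _) h0 H.
by rewrite -powRrM mulVf ?gt_eqF// powRr1.
Qed.

(* [(1 + h)^r = (1 + h) (1 + h)^(r - 1)], and [r - 1 <= 1]. *)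
Lemma powR_le_quadratic r h : 1 <= r -> r <= 2 -> -1 <= h ->
  (1 + h) `^ r <= 1 + r * h + (r - 1) * h ^+ 2.
Proof.
move=> r1 r2 h1; have h0 : 0 <= 1 + h by lra.
have r0 : 0 < r by lra.
rewrite -(mulr_powRB1 h0 r0).
have : (1 + h) `^ (r - 1) <= 1 + (r - 1) * h.
  by apply: powR_le_tangent => //; lra.
move=> /(ler_wpM2l h0) /le_trans; apply.
by rewrite le_eqVlt; apply/orP; left; apply/eqP; ring.
Qed.

(** Since e^2 = e^r e^(2 - r) and 2 - r > 0, the second factor can be made as small as desired. This
    is the one place where an exponent below 2 defeats a quadratic bound. *)
Lemma powR_superquadratic r (m C eta : R) : 0 < m -> 0 < eta -> r < 2 ->
  exists e, [/\ 0 < e, e <= eta & C * e ^+ 2 < (e * m) `^ r].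
Proof.
move=> m0 eta0 r2; have s0 : 0 < 2 - r by lra.
have mr0 : 0 < m `^ r by rewrite powR_gt0.
have C0 : 0 < `|C| + 1 by have := normr_ge0 C; lra.
(* The solution of d^(2 - r) = m^r / (|C| + 1); the added 1 keeps the denominator positive and the
   final inequality strict. *)
pose d := (m `^ r / (`|C| + 1)) `^ (2 - r)^-1.
have d0 : 0 < d by apply: powR_gt0; apply: divr_gt0.
exists (Num.min eta d); set e := Num.min _ _.
have e0 : 0 < e by rewrite lt_min eta0.
split => //; first by rewrite ge_min lexx.
rewrite powRM ?ltW//.
have e2 : e ^+ 2 = e `^ r * e `^ (2 - r).
  rewrite -powRD; last by rewrite (gt_eqF e0) implybT.
  by rewrite addrC subrK powR_mulrn// ltW.
rewrite e2 mulrCA ltr_pM2l ?powR_gt0//.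
have : e `^ (2 - r) <= m `^ r / (`|C| + 1).
  have -> : m `^ r / (`|C| + 1) = d `^ (2 - r).
    by rewrite -powRrM mulVf ?gt_eqF// powRr1// divr_ge0// ltW.
  by apply: (ge0_ler_powR (ltW s0) (ltW e0) (ltW d0)); rewrite ge_min lexx orbT.
rewrite ler_pdivlMr// => /lt_le_trans; apply.
rewrite mulrC ltr_pM2l ?powR_gt0//.
by have := ler_norm C; lra.
Qed.

(** Otherwise a small [e] of sign opposite to [a] makes the linear term negative and dominant. *)
Lemma quadratic_ge0_slope (a b eta : R) : 0 < eta ->
  (forall e, `|e| <= eta -> 0 <= a * e + b * e ^+ 2) -> a = 0.
Proof.
move=> eta0 H; apply/eqP; case: (eqVneq a 0) => // an0.
have b0 : 0 < `|b| + 1 by have := normr_ge0 b; lra.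
have an : 0 < `|a| by rewrite normr_gt0.
pose e := Num.min eta (`|a| / (`|b| + 1)) .
have e0 : 0 < e by rewrite lt_min eta0 divr_gt0.
have e1 : e <= eta by rewrite ge_min lexx.
have e2 : e * (`|b| + 1) <= `|a|.
  by rewrite -ler_pdivlMr// ge_min lexx orbT.
have := H (- Num.sg a * e).
rewrite normrM normrN normr_sg an0 mul1r gtr0_norm// => /(_ e1).
have -> : a * (- Num.sg a * e) = - (`|a| * e) by rewrite [`|a|]normrEsg; ring.
rewrite exprMn sqrrN sqr_sg an0 mul1r.
have := ler_norm b; nra.
Qed.

End Bernoulli.

(** * Coordinates on the cone and its vertices *)

Section Points.
Context {R : realType} {n : nat}.
Implicit Types (s t c : R) (x y : 'cV[R]_n).

Definition pt t x : 'cV[R]_(1 + n) := col_mx t%:M x.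

Lemma pt_eta (v : 'cV[R]_(1 + n)) : v = pt (usubmx v ord0 ord0) (dsubmx v).
Proof. by rewrite /pt -mx11_scalar vsubmxK. Qed.

Lemma ptD s t x y : pt s x + pt t y = pt (s + t) (x + y).
Proof. by rewrite /pt add_col_mx raddfD. Qed.

Lemma ptZ c t x : c *: pt t x = pt (c * t) (c *: x).
Proof. by rewrite /pt scale_col_mx scale_scalar_mx. Qed.

Lemma pt_inj s t x y : pt s x = pt t y -> s = t /\ x = y.
Proof.
move=> /eq_col_mx[/matrixP/(_ ord0 ord0)]; rewrite !mxE eqxx !mulr1n.
by move=> -> ->.
Qed.

(** Removes the outer root. The sign of [t] becomes a separate condition, since the power of a
    negative base is only a default value. *)
Lemma pcone_ptE r t x : 1 <= r ->
  pcone r%:E n (pt t x) <-> 0 <= t /\ \sum_(i < n) `|x i ord0| `^ r <= t `^ r.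
Proof.
move=> r1; have r0 : 0 < r by lra.
have S0 : 0 <= \sum_(i < n) `|x i ord0| `^ r.
  by apply: sumr_ge0 => i _; exact: powR_ge0.
have rK a : 0 <= a -> (a `^ r^-1) `^ r = a.
  by move=> a0; rewrite -powRrM mulVf ?gt_eqF// powRr1.
have Kr a : 0 <= a -> (a `^ r) `^ r^-1 = a.
  by move=> a0; rewrite -powRrM divff ?gt_eqF// powRr1.
rewrite /pcone /pt /= col_mxKd col_mxKu mxE eqxx mulr1n; split.
  move=> H; have t0 : 0 <= t by apply: le_trans H; exact: powR_ge0.
  split => //; rewrite -[leLHS]rK//.
  by apply: ge0_ler_powR H; rewrite ?nnegrE ?powR_ge0// ltW.
move=> [t0 H]; rewrite -[leRHS]Kr//.
by apply: ge0_ler_powR H; rewrite ?nnegrE ?powR_ge0// invr_ge0 ltW.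
Qed.

Lemma pcone_oo_ptE t x :
  pcone +oo%E n (pt t x) <-> 0 <= t /\ forall i, `|x i ord0| <= t.
Proof.
rewrite /pcone /pt /= col_mxKd col_mxKu mxE eqxx mulr1n; split.
  by move=> /bigmax_leP[t0 H]; split => // i; exact: H.
by move=> [t0 H]; apply/bigmax_leP; split.
Qed.

Definition vertex (i : 'I_n) (b : bool) := pt 1 ((-1) ^+ b *: delta_mx i ord0).

(** The sum of opposite vertices does not depend on [i]: this relation later pins down the image of
    the axis. *)
Lemma vertexD i b : vertex i b + vertex i (~~ b) = pt 2 0.
Proof. by rewrite /vertex ptD; case: b; rewrite /= ?scaleN1r ?scale1r ?addNr ?subrr. Qed.

Lemma pcone_vertex r i b : 1 <= r -> pcone r%:E n (vertex i b).
Proof.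
move=> r1; apply/pcone_ptE => //; split=> //.
rewrite (bigD1 i)//= !mxE !eqxx mulr1 normrX normrN1 expr1n powR1.
rewrite big1 ?addr0// => j ji; rewrite !mxE (negPf ji) mulr0 normr0 powR0//.
by rewrite gt_eqF//; lra.
Qed.

End Points.

(** * Smooth directions at the vertices *)

Section SmoothDirections.
Context {R : realType}.

(* [w] is a direction in which the boundary of [K] at [v] is smooth to second
   order; allowing an arbitrary correction [u] makes the notion visibly
   invariant under linear automorphisms of [K]. *)
Definition smooth_dir {m} (K : set 'cV[R]_m) (v w : 'cV[R]_m) :=
  exists u, exists2 eta : R, 0 < eta &
    forall e : R, `|e| <= eta -> K (v + e *: w + e ^+ 2 *: u).

Lemma smooth_dir_mulmx {m} (K : set 'cV[R]_m) (A : 'M[R]_m) v w :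
  (forall v, K v -> K (A *m v)) ->
  smooth_dir K v w -> smooth_dir K (A *m v) (A *m w).
Proof.
move=> AK [u [eta eta0 H]]; exists (A *m u), eta => // e /H /AK.
by rewrite !mulmxDr -!scalemxAr.
Qed.

(** To first order, coordinate [i] forces [s] to be the signed [y i]. Any other nonzero [y k] would
    then add a term of order e^r to the norm sum, while the room left by coordinate [i] is only of
    order e^2. *)
Lemma vertex_smooth_dir {n} (r : R) i b (w : 'cV[R]_(1 + n)) :
  1 <= r -> r < 2 ->
  smooth_dir (pcone r%:E n) (vertex i b) w -> exists l, w = l *: vertex i b.
Proof.
move=> r1 r2; have r0 : 0 < r by lra.
rewrite [w]pt_eta; move: (usubmx w ord0 ord0) (dsubmx w) => s y {w}.
move=> [u [eta eta0]]; rewrite [u]pt_eta.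
move: (usubmx u ord0 ord0) (dsubmx u) => q z {u} H.
pose g : R := (-1) ^+ b.
have gg : g * g = 1 by rewrite /g -expr2 sqrr_sign.
have gn : `|g| = 1 by rewrite /g normr_sign.
pose T e := 1 + e * s + e ^+ 2 * q.
pose a k e := e * y k ord0 + e ^+ 2 * z k ord0.
have Hb (e : R) : `|e| <= eta -> 0 <= T e /\
    `|g + a i e| `^ r + \sum_(k < n | k != i) `|a k e| `^ r <= T e `^ r.
  move=> /H; rewrite /vertex !ptZ !ptD => /pcone_ptE-/(_ r1)[T0].
  rewrite (bigD1 i)//= => S; split => //; apply: le_trans S.
  rewrite lerD//; first by rewrite !mxE !eqxx mulr1 addrA.
  by apply: ler_sum => k ki; rewrite !mxE (negPf ki) mulr0 add0r.
have Hi (e : R) : `|e| <= eta -> g * (g + a i e) <= T e.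
  move=> /Hb[T0 S]; apply: (@le_trans _ _ `|g + a i e|).
    by rewrite -[leRHS]mul1r -gn -normrM ler_norm.
  rewrite leNgt; apply/negP => /(gt0_ltr_powR r0); rewrite !nnegrE.
  move=> /(_ T0 (normr_ge0 _)); apply/negP; rewrite -leNgt; apply: le_trans S.
  by rewrite lerDl sumr_ge0// => k _; exact: powR_ge0.
(* [Hi] holds for [e] of both signs, so the linear coefficient of the difference vanishes. *)
have sy : s = g * y i ord0.
  apply/eqP; rewrite -subr_eq0; apply/eqP.
  apply: (@quadratic_ge0_slope _ _ (q - g * z i ord0) eta eta0) => e /Hi.
  by rewrite mulrDr gg /T /a; nra.
exists s; rewrite /vertex ptZ mulr1 -/g; congr pt; apply/colP => k.
rewrite !mxE; case: (eqVneq k i) => [->|ki] /=.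
  by rewrite sy mulr1 mulrAC gg mul1r.
rewrite !mulr0; apply/eqP; case: (eqVneq (y k ord0) 0) => // yk0.
(* Half of |y_k|: the correction e^2 z_k may use up the other half. *)
pose m : R := `|y k ord0| / 2.
have m0 : 0 < m by rewrite divr_gt0// normr_gt0.
pose D := q - g * z i ord0.
have [M [M1 sM zM zkM]] : exists M : R, [/\ 1 <= M, `|s| <= M,
    `|g * z i ord0| <= M & `|z k ord0| <= M].
  exists (1 + `|s| + `|g * z i ord0| + `|z k ord0|).
  have := (normr_ge0 s, normr_ge0 (g * z i ord0), normr_ge0 (z k ord0)).
  by move=> [[? ?] ?]; split; lra.
have M0 : 0 < M by lra.
pose eta' : R := Num.min eta (Num.min (1 / (4 * M)) (m / M)).
have M4 : 0 < 1 / (4 * M) by apply: divr_gt0; lra.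
have eta'0 : 0 < eta' by rewrite !lt_min eta0 M4 divr_gt0.
(* The constant 16 comes from the bounds B^r <= 4 and h <= 2 e^2 D below, which give 4 (2 h + h^2)
   <= 16 e^2 (D + D^2). *)
have [e [e0 ee]] := powR_superquadratic _ _ (16 * (`|D| + `|D| ^+ 2)) _ m0 eta'0 r2.
(* What remains is the opposite bound on (e m)^r, contradicting the choice of [e]. *)
apply: contraLR => _; rewrite -leNgt.
have e_eta : `|e| <= eta.
  by rewrite gtr0_norm//; apply: le_trans ee _; rewrite ge_min lexx.
have eM : e * M * 4 <= 1.
  have : e <= 1 / (4 * M) by apply: le_trans ee _; rewrite !ge_min lexx !orbT.
  by rewrite ler_pdivlMr; lra.
have em : e * M <= m.
  have : e <= m / M by apply: le_trans ee _; rewrite !ge_min lexx !orbT.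
  by rewrite ler_pdivlMr.
pose B := g * (g + a i e).
have BE : B = 1 + e * s + e ^+ 2 * (g * z i ord0).
  by rewrite /B mulrDr gg /a sy; ring.
have TB : T e = B + e ^+ 2 * D by rewrite BE /T /D; ring.
have [T0 S] := Hb _ e_eta.
have e1 : e <= 1 by nra.
have bnd (c : R) : `|c| <= M -> `|e * c| <= 1 / 4.
  by move=> cM; rewrite normrM gtr0_norm//; nra.
have B1 : `|e * s| <= 1 / 4 by exact: bnd.
have B2 : `|e * (g * z i ord0)| <= 1 / 4 by exact: bnd.
have Bhalf : 1 / 2 <= B.
  rewrite BE; move: B1 B2; rewrite !ler_norml => /andP[? ?] /andP[? ?].
  by rewrite expr2 -mulrA; nra.
have B2' : B <= 2.
  rewrite BE; move: B1 B2; rewrite !ler_norml => /andP[? ?] /andP[? ?].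
  by rewrite expr2 -mulrA; nra.
have D0 : 0 <= D.
  have := Hi _ e_eta; rewrite -/B TB lerDl pmulr_rge0// exprn_gt0//.
have Br : B `^ r <= 4.
  apply: (@le_trans _ _ (2 `^ r)).
    by apply: ge0_ler_powR; rewrite ?nnegrE; lra.
  apply: (@le_trans _ _ (2 `^ 2)); first by apply: ler_powR; lra.
  by rewrite powR_mulrn//; lra.
have aB : `|g + a i e| = B.
  by rewrite -[LHS]mul1r -gn -normrM ger0_norm// -/B; lra.
have Hk : (e * m) `^ r <= `|a k e| `^ r.
  apply: ge0_ler_powR; rewrite ?nnegrE ?normr_ge0//; [lra|nra|].
  have -> : a k e = e * (y k ord0 + e * z k ord0) by rewrite /a; ring.
  rewrite normrM gtr0_norm// ler_pM2l//.
  have h1 : `|e * z k ord0| <= m.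
    rewrite normrM gtr0_norm//; apply: le_trans em.
    by rewrite ler_pM2l.
  have := lerB_normD (y k ord0) (e * z k ord0).
  have : `|y k ord0| = 2 * m by rewrite /m; field.
  lra.
pose h := e ^+ 2 * D / B.
have e2D : 0 <= e ^+ 2 * D by rewrite mulr_ge0// exprn_ge0// ltW.
have h0 : 0 <= h by rewrite divr_ge0//; lra.
have h2 : h <= 2 * (e ^+ 2 * D) by rewrite ler_pdivrMr; nra.
have TBh : T e = B * (1 + h) by rewrite TB /h; field; lra.
have Tr : T e `^ r <= B `^ r * (1 + 2 * h + h ^+ 2).
  rewrite TBh powRM//; [|lra|lra].
  apply: ler_wpM2l; first exact: powR_ge0.
  apply: le_trans (powR_le_quadratic _ _ r1 (ltW r2) _) _; first lra.
  by have := sqr_ge0 h; nra.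
have Sk : `|a k e| `^ r <= \sum_(k < n | k != i) `|a k e| `^ r.
  by rewrite (bigD1 k)//= lerDl sumr_ge0// => ? _; exact: powR_ge0.
rewrite aB in S; apply: (le_trans Hk); apply: (le_trans Sk).
have S' : \sum_(k < n | k != i) `|a k e| `^ r <= B `^ r * (2 * h + h ^+ 2).
  by move: S Tr; lra.
apply: (le_trans S'); apply: (@le_trans _ _ (4 * (2 * h + h ^+ 2))).
  by apply: ler_wpM2r => //; have := sqr_ge0 h; lra.
rewrite ger0_norm//.
have h3 : h ^+ 2 <= 4 * (e ^+ 2 * D ^+ 2).
  apply: (@le_trans _ _ ((2 * (e ^+ 2 * D)) ^+ 2)).
    by rewrite ler_sqr ?nnegrE//; lra.
  have e2 : e ^+ 2 <= 1 by rewrite expr_le1// ltW.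
  have := mulr_ge0 (sqr_ge0 e) (sqr_ge0 D); nra.
lra.
Qed.

End SmoothDirections.

(** * Extra smooth directions away from the vertices *)

Section NonVertex.
Context {R : realType} {n : nat}.
Implicit Types (r t : R) (x : 'cV[R]_n).

(** An interior point can move in every direction, so any direction off its own line serves: a basis
    vector if [x = 0], the axis otherwise. *)
Lemma smooth_dir_interior r t x : 1 <= r -> 0 < t -> (0 < n)%N ->
  \sum_(i < n) `|x i ord0| `^ r < t `^ r ->
  exists w, smooth_dir (pcone r%:E n) (pt t x) w /\
    ~ exists l : R, w = l *: pt t x.
Proof.
move=> r1 t0 n0 St; have r0 : 0 < r by lra.
case: (eqVneq x 0) => [->|xn0].
  pose i := Ordinal n0.
  exists (pt 0 (delta_mx i ord0)); split.
    exists 0, t => // e et; rewrite scaler0 addr0 ptZ ptD mulr0 addr0 add0r.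
    apply/pcone_ptE => //; split; first exact: ltW.
    rewrite (bigD1 i)//= big1 ?addr0.
      rewrite !mxE !eqxx mulr1; apply: ge0_ler_powR => //; first exact: ltW.
      by rewrite nnegrE ltW.
    move=> j ji; rewrite !mxE (negPf ji) mulr0 normr0 powR0//.
    by rewrite gt_eqF.
  move=> [l]; rewrite ptZ scaler0 => /pt_inj[_ /matrixP/(_ i ord0)].
  by rewrite !mxE !eqxx => /eqP; rewrite oner_eq0.
set S := \sum_(i < n) _ in St.
have S0 : 0 <= S by apply: sumr_ge0 => i _; exact: powR_ge0.
pose N := S `^ r^-1.
have NS : N `^ r = S by rewrite /N -powRrM mulVf ?gt_eqF// powRr1.
have N0 : 0 <= N by exact: powR_ge0.
have Nt : N < t.
  rewrite ltNge; apply/negP => tN; move: St; rewrite -NS ltNge => /negP; apply.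
  by apply: ge0_ler_powR => //; rewrite ?nnegrE ltW.
exists (pt 1 0); split.
  exists 0, (t - N); first by rewrite subr_gt0.
  move=> e; rewrite ler_norml => /andP[e1 e2].
  rewrite scaler0 addr0 ptZ ptD mulr1 scaler0 addr0.
  apply/pcone_ptE => //; split; first lra.
  by rewrite -/S -NS; apply: ge0_ler_powR; rewrite ?nnegrE; lra.
move=> [l]; rewrite ptZ => /pt_inj[lt /esym/eqP]; rewrite scaler_eq0.
rewrite (negPf xn0) orbF => /eqP l0; move: lt; rewrite l0 mul0r => /eqP.
by rewrite oner_eq0.
Qed.

(* Scaling the single coordinate [x_i] moves [v] inside the cone along a curve
   with second-order contact with the boundary. *)
Lemma smooth_dir_boundary r t x i j : 1 <= r -> r <= 2 -> 0 < t ->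
  \sum_(i < n) `|x i ord0| `^ r = t `^ r ->
  j != i -> x i ord0 != 0 -> x j ord0 != 0 ->
  exists w, smooth_dir (pcone r%:E n) (pt t x) w /\
    ~ exists l : R, w = l *: pt t x.
Proof.
move=> r1 r2 t0 St ji xi xj; have r0 : 0 < r by lra.
pose a := `|x i ord0| `^ r; pose b := a / t `^ r.
have a0 : 0 <= a by exact: powR_ge0.
have tr0 : 0 < t `^ r by exact: powR_gt0.
have ab : a = t `^ r * b by rewrite /b mulrC divfK// gt_eqF.
have b0 : 0 <= b by rewrite divr_ge0// ltW.
have b1 : b <= 1.
  rewrite ler_pdivrMr// mul1r -St (bigD1 i)//= lerDl.
  by apply: sumr_ge0 => k _; exact: powR_ge0.
(* The slope [t * b] balances first order: both sides of the cone inequality change by r a e.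
   Coordinate [j], unmoved but nonzero, shows that the direction is not a multiple of the point. *)
exists (pt (t * b) (x i ord0 *: delta_mx i ord0)); split; last first.
  move=> [l]; rewrite ptZ => /pt_inj[_ /matrixP xE].
  have /eqP := xE i ord0; have /eqP := xE j ord0.
  rewrite !mxE !eqxx (negPf ji) mulr0 mulr1 eq_sym mulf_eq0 (negPf xj) orbF.
  by move=> /eqP ->; rewrite mul0r (negPf xi).
(* The correction adds r a e^2 on the right, which covers the (r - 1) a e^2 that [powR_le_quadratic]
   allows on the left. *)
exists (pt (t * b) 0), (1 / 4); first lra.
move=> e; rewrite ler_norml => /andP[e1 e2].
pose k := b * (e + e ^+ 2).
have k1 : - (1 / 4) <= k by rewrite /k; nra.
rewrite !ptZ !ptD scaler0 addr0.
have -> : t + e * (t * b) + e ^+ 2 * (t * b) = t * (1 + k) by rewrite /k; ring.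
apply/pcone_ptE => //; split; first by rewrite mulr_ge0//; lra.
rewrite (bigD1 i)//= !mxE !eqxx mulr1.
under eq_bigr => l li do rewrite !mxE (negPf li) !mulr0 addr0.
have -> : x i ord0 + e * x i ord0 = x i ord0 * (1 + e) by ring.
have e1' : 0 <= 1 + e by lra.
have k1' : 0 <= 1 + k by lra.
rewrite normrM (ger0_norm e1') (powRM _ (normr_ge0 _) e1') -/a.
rewrite (powRM _ (ltW t0) k1').
have H1 : a * (1 + e) `^ r <= a * (1 + r * e + (r - 1) * e ^+ 2).
  by apply: ler_wpM2l => //; apply: powR_le_quadratic; lra.
have H2 : t `^ r * (1 + r * k) <= t `^ r * (1 + k) `^ r.
  apply: ler_wpM2l; first exact: ltW.
  by apply: powR_ge_tangent => //; nra.
apply: le_trans H2; move: St; rewrite (bigD1 i)//= -/a => St.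
have -> : t `^ r * (1 + r * k) = t `^ r + a * (r * (e + e ^+ 2)).
  by rewrite /k ab; ring.
by have := sqr_ge0 e; nra.
Qed.

(** Converse of [vertex_smooth_dir]: interior points, and boundary points with two nonzero
    coordinates, have a further smooth direction. So only one coordinate survives, of absolute value
    [t]. *)
Lemma vertexP r (v : 'cV[R]_(1 + n)) : 1 <= r -> r <= 2 -> (0 < n)%N ->
  pcone r%:E n v -> v != 0 ->
  (forall w, smooth_dir (pcone r%:E n) v w -> exists l : R, w = l *: v) ->
  exists c j b, 0 < c /\ v = c *: vertex j b.
Proof.
move=> r1 r2 n0; rewrite [v]pt_eta.
move: (usubmx v ord0 ord0) (dsubmx v) => t x {v}.
move=> /pcone_ptE-/(_ r1)[t_ge0 St] vn0 H; have r0 : 0 < r by lra.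
have pos i : 0 <= `|x i ord0| `^ r by exact: powR_ge0.
have t0 : 0 < t.
  rewrite lt_def t_ge0 andbT; apply: contra vn0 => /eqP tE; apply/eqP.
  move: St; rewrite tE powR0 ?gt_eqF// => St.
  have -> : x = 0.
    apply/colP => i; rewrite mxE; apply/eqP; rewrite -normr_eq0.
    have : `|x i ord0| `^ r == 0.
      rewrite eq_le pos andbT; apply: le_trans St.
      by rewrite (bigD1 i)//= lerDl sumr_ge0.
    by rewrite powR_eq0 => /andP[].
  by rewrite /pt raddf0 col_mx0.
move: St; rewrite le_eqVlt => /orP[/eqP St|St]; last first.
  have [w [/H]] := smooth_dir_interior _ _ _ r1 t0 n0 St.
  by [].
have [i xi] : exists i, x i ord0 != 0.
  apply/not_existsP => x0; have := powR_gt0 r t0; rewrite -St big1 ?ltxx//.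
  move=> i _; have /negP := x0 i; rewrite negbK => /eqP ->.
  by rewrite normr0 powR0// gt_eqF.
have xj j : j != i -> x j ord0 = 0.
  move=> ji; apply/eqP; apply: contraT => xj.
  have [w [/H]] := smooth_dir_boundary _ _ _ _ _ r1 r2 t0 St ji xi xj.
  by [].
have xt : `|x i ord0| = t.
  move: St; rewrite (bigD1 i)//= big1 ?addr0.
    by apply: (powR_injective r0); rewrite nnegrE// ltW.
  by move=> j /xj ->; rewrite normr0 powR0// gt_eqF.
exists t, i, (x i ord0 < 0)%R; split => //.
rewrite /vertex ptZ mulr1; congr pt; apply/colP => j; rewrite !mxE.
case: (eqVneq j i) => [->|/xj ->]; last by rewrite !mulr0.
by rewrite mulr1 -xt mulrC -realEsign ?num_real.
Qed.

End NonVertex.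

(** * Generalized permutation matrices and their action on the cones *)

Section SignedPermutations.
Context {R : realType} {n : nat}.

(** Indexed by columns, to match the action on vertices: basis vector [i] goes to plus or minus
    basis vector [f i]. *)
Definition signed_perm_mx (f : 'I_n -> 'I_n) (s : 'I_n -> bool) : 'M[R]_n :=
  \matrix_(k, i) ((-1) ^+ s i *+ (k == f i)).

Lemma gen_perm_mxP (P : 'M[R]_n) :
  gen_perm_mx P <->
  exists (s : 'S_n) (b : 'I_n -> bool), P = signed_perm_mx s b.
Proof.
split=> [[Q [d [/is_perm_mxP[s ->] d1 ->]]]|[s [b ->]]].
  have N1 : (1 == -1 :> R) = false.
    by rewrite -subr_eq0 opprK -[1 + 1]/(2%:R) pnatr_eq0.
  (* The inverse appears because [perm_mx s] has its ones at the positions (k, s k), a row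
     convention. *)
  exists (s^-1)%g, (fun i => d ord0 i == -1).
  apply/matrixP => k i; rewrite mul_mx_diag !mxE (canF_eq (permK s)).
  have dE : d ord0 i = (-1) ^+ (d ord0 i == -1).
    by case: (d1 i) => ->; rewrite ?N1 ?eqxx.
  by rewrite {1}dE mulr_natl.
exists (perm_mx (s^-1)%g), (\row_i (-1) ^+ b i); split.
- by apply/is_perm_mxP; exists (s^-1)%g.
- by move=> i; rewrite mxE; case: (b i); [right|left].
- apply/matrixP => k i; rewrite mul_mx_diag !mxE (canF_eq (permKV s)).
  by rewrite mulr_natl.
Qed.

Lemma signed_perm_mx_tr (s : 'S_n) b :
  (signed_perm_mx s b)^T = signed_perm_mx (s^-1)%g (b \o (s^-1)%g).
Proof.
apply/matrixP => i k; rewrite !mxE /=.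
rewrite eq_sym (canF_eq (permK s)); case: eqP => [<-|]; last by rewrite !mulr0n.
by rewrite -[i]/(i).
Qed.

Lemma gen_perm_mx_tr (P : 'M[R]_n) : gen_perm_mx P -> gen_perm_mx P^T.
Proof.
move=> /gen_perm_mxP[s [b ->]]; rewrite signed_perm_mx_tr.
by apply/gen_perm_mxP; exists (s^-1)%g, (b \o (s^-1)%g).
Qed.

Lemma mul_signed_perm_mx (s : 'S_n) b (x : 'cV[R]_n) i :
  (signed_perm_mx s b *m x) (s i) ord0 = (-1) ^+ b i * x i ord0.
Proof.
rewrite mxE (bigD1 i)//= big1 ?addr0; first by rewrite mxE eqxx.
move=> j ji; rewrite mxE (inj_eq perm_inj) eq_sym (negPf ji).
by rewrite mulr0n mul0r.
Qed.

(** The matrix is orthogonal, so its transpose inverts it. *)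
Lemma signed_perm_mx_unit (s : 'S_n) b : signed_perm_mx s b \in unitmx.
Proof.
have : signed_perm_mx s b *m (signed_perm_mx s b)^T = 1%:M.
  apply/matrixP => k l; rewrite -[k](permKV s).
  set k' := (s^-1)%g k; set M := signed_perm_mx s b.
  have -> : (M *m M^T) (s k') l = (M *m col l M^T) (s k') ord0.
    by rewrite !mxE; apply: eq_bigr => j _; rewrite !mxE.
  rewrite mul_signed_perm_mx !mxE mulrnAr -expr2 sqrr_sign.
  by rewrite eq_sym.
by move=> /mulmx1_unit[].
Qed.

Lemma pnorm_signed_perm_mx (p : \bar R) (s : 'S_n) b x : p <> -oo%E ->
  pnorm p (signed_perm_mx s b *m x) = pnorm p x.
Proof.
have nE i : `|(signed_perm_mx s b *m x) (s i) ord0| = `|x i ord0|.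
  by rewrite mul_signed_perm_mx normrM normr_sign mul1r.
case: p => [r||] pE; last by [].
  rewrite /pnorm; congr (_ `^ _).
  by rewrite (reindex_inj (@perm_inj _ s)); apply: eq_bigr => i _; rewrite nE.
rewrite /pnorm (reindex_inj (@perm_inj _ s)).
by apply: eq_bigr => i _; rewrite nE.
Qed.

Lemma pnormZ (p : \bar R) (a : R) (x : 'cV[R]_n) : (1%:E <= p)%E -> 0 <= a ->
  pnorm p (a *: x) = a * pnorm p x.
Proof.
have nE i : 0 <= a -> `|(a *: x) i ord0| = a * `|x i ord0|.
  by move=> a0; rewrite mxE normrM ger0_norm.
case: p => [r||] //=; last first.
  move=> _ a0; rewrite (big_morph ( *%R a) (id1 := 0) (op1 := Num.max)).
  - by apply: eq_bigr => i _; exact: nE.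
  - by move=> u v; rewrite maxr_pMr.
  - by rewrite mulr0.
rewrite lee_fin => r1 a0; have r0 : r != 0 by rewrite gt_eqF//; lra.
under eq_bigr => i _ do rewrite nE// powRM//.
rewrite -mulr_sumr powRM ?powR_ge0 ?sumr_ge0//.
by rewrite -powRrM divff// powRr1.
Qed.

(** Signed permutations preserve every p-norm, and a positive factor scales both sides of the cone
    inequality. As the matrix does not involve [p], this yields the equality of the groups. *)
Lemma cone_aut_signed_perm (p : \bar R) (a : R) (P : 'M[R]_n) :
  (1%:E <= p)%E -> 0 < a -> gen_perm_mx P ->
  cone_aut (pcone p n) (a *: block_mx (1%:M : 'M[R]_1) 0 0 P).
Proof.
move=> p1 a0 /gen_perm_mxP[s [b ->]]; set P0 := signed_perm_mx s b.
set M := (X in cone_aut _ X).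
have Mu : M \in unitmx.
  rewrite unitmxZ ?unitfE ?gt_eqF// unitmxE det_ublock det1 mul1r -unitmxE.
  exact: signed_perm_mx_unit.
have MK v : pcone p n (M *m v) <-> pcone p n v.
  rewrite [v]pt_eta; move: (usubmx v _ _) (dsubmx v) => t x.
  rewrite /M -scalemxAl /pt mul_block_col mul1mx !mul0mx addr0 add0r.
  rewrite scale_col_mx /pcone /= !col_mxKd !col_mxKu
    (pnormZ _ _ _ p1 (ltW a0)) pnorm_signed_perm_mx; last first.
    by move=> pE; move: p1; rewrite pE.
  by rewrite !mxE ler_pM2l.
split => //; apply/seteqP; split => [_ [v /MK Kv <-]//|v Kv].
exists (invmx M *m v); last by rewrite mulmxA mulmxV// mul1mx.
by apply/MK; rewrite mulmxA mulmxV// mul1mx.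
Qed.

End SignedPermutations.

(** * From permuted vertex rays to the block form *)

Section Vertices.
Context {R : realType} {n : nat}.
Implicit Types (c : R) (A B : 'M[R]_(1 + n)).

(** Distinct vertices span distinct rays: the first coordinate forces [c = 1]. *)
Lemma vertex_inj c i b j b' : @vertex R n i b = c *: vertex j b' ->
  i = j /\ b = b'.
Proof.
rewrite /vertex ptZ mulr1 => /pt_inj[<-]; rewrite scale1r.
move=> /colP/(_ i); rewrite !mxE !eqxx mulr1.
case: (eqVneq i j) => [->|_] /=; last first.
  by rewrite mulr0 => /eqP; rewrite signr_eq0.
by rewrite mulr1 => /(@signr_inj R).
Qed.

Lemma mulmx_pt_ext A B : A *m pt 1 0 = B *m pt 1 0 ->
  (forall i, A *m pt 0 (delta_mx i ord0) = B *m pt 0 (delta_mx i ord0)) ->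
  A = B.
Proof.
move=> H0 H; have dl : delta_mx (lshift n ord0) ord0 = pt 1 0 :> 'cV[R]_(1 + n).
  by rewrite delta_mx_ushift /pt; congr col_mx; apply/matrixP => i j;
    rewrite !mxE !ord1.
have dr i : delta_mx (rshift 1 i) ord0 = pt 0 (delta_mx i ord0) :> 'cV[R]_(1 + n).
  by rewrite delta_mx_dshift /pt raddf0.
apply/matrixP => k l; suff : col l A = col l B by move=> /colP/(_ k); rewrite !mxE.
rewrite !colE; case: (split_ordP l) => l' ->; last by rewrite dr H.
by rewrite [l']ord1 dl H0.
Qed.

Lemma vertex_perm_form A B : (2 <= n)%N -> B *m A = 1%:M ->
  (forall i b, exists c j b', 0 < c /\ A *m vertex i b = c *: vertex j b') ->
  exists (alpha : R) (P : 'M[R]_n), [/\ 0 < alpha, gen_perm_mx P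
    & A = alpha *: block_mx (1%:M : 'M[R]_1) 0 0 P].
Proof.
move=> n2 BA HA.
have /boolp.choice[f Hf] : forall ib : 'I_n * bool, exists cjb : R * ('I_n * bool),
    0 < cjb.1 /\ A *m vertex ib.1 ib.2 = cjb.1 *: vertex cjb.2.1 cjb.2.2.
  by move=> [i b]; have [c [j [b' H]]] := HA i b; exists (c, (j, b')).
pose cf i b := (f (i, b)).1; pose jf i b := (f (i, b)).2.1.
pose bf i b := (f (i, b)).2.2.
have cf0 i b : 0 < cf i b by case: (Hf (i, b)).
have AE i b : A *m vertex i b = cf i b *: vertex (jf i b) (bf i b).
  by case: (Hf (i, b)).
have f_inj i b i' b' : jf i b = jf i' b' -> bf i b = bf i' b' ->
    i = i' /\ b = b'.
  move=> ij bb; apply: (vertex_inj (cf i b / cf i' b')).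
  rewrite -[LHS]mul1mx -BA -mulmxA AE ij bb -[in RHS](mul1mx (vertex i' b')) -BA.
  by rewrite -mulmxA AE -!scalemxAr scalerA divfK// gt_eqF.
have [g [h gh]] : exists g h, A *m pt 2 0 = pt g h.
  by exists (usubmx (A *m pt 2 0) ord0 ord0), (dsubmx (A *m pt 2 0)); rewrite -pt_eta.
have sumE i b : g = cf i b + cf i (~~ b) /\ forall k, h k ord0 =
    (-1) ^+ bf i b * (cf i b *+ (k == jf i b)) +
    (-1) ^+ bf i (~~ b) * (cf i (~~ b) *+ (k == jf i (~~ b))).
  have := gh; rewrite -(vertexD i b) mulmxDr !AE /vertex !ptZ ptD !mulr1.
  move=> /pt_inj[<- <-]; split => // k; rewrite !mxE !andbT.
  by congr (_ + _); rewrite mulrA mulr_natr mulrC mulrnAr.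
(* If [h] has a nonzero coordinate [m], then for every [i] one of the two images
   must be the vertex on the side of [h m], against injectivity. *)
have h0 : h = 0.
  apply/colP => m; rewrite mxE; apply/eqP; apply: contraT => hm.
  have pick i : exists b, jf i b = m /\ bf i b = (h m ord0 < 0).
    apply/not_existsP => K.
    have neg b : (-1) ^+ (h m ord0 < 0)%R *
        ((-1) ^+ bf i b * (cf i b *+ (m == jf i b))) <= 0.
      case: eqP => [mj|_]; last by rewrite mulr0n !mulr0.
      have : bf i b != (h m ord0 < 0).
        by apply/eqP => bE; apply: (K b).
      have := cf0 i b; rewrite mulr1n.
      by case: (bf i b); case: (h m ord0 < 0) => //=; rewrite !(expr0, expr1); lra.
    have := lerD (neg false) (neg true); rewrite -mulrDr.
    have [_ /(_ m) /= <-] := sumE i false; rewrite addr0 -normrEsign.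
    by rewrite normr_le0 (negPf hm).
  (* [Ordinal n1] is index 0 and [Ordinal n2] is index 1, as [2 <= n] unfolds to 1 < n. *)
  have n1 : (0 < n)%N by exact: leq_trans n2.
  have [b [j1 b1]] := pick (Ordinal n1); have [b' [j2 b2]] := pick (Ordinal n2).
  by have [] : Ordinal n1 = Ordinal n2 /\ b = b' by apply: f_inj; congruence.
(* With [h = 0] the two images cancel outside the first coordinate, so they are opposite vertices of
   equal weight, half of [g] whatever [i] is. *)
have opp i b : [/\ jf i (~~ b) = jf i b, bf i (~~ b) = ~~ bf i b
    & cf i b = g / 2].
  have [gE /(_ (jf i b))] := sumE i b; rewrite h0 mxE eqxx mulr1n.
  have := cf0 i b; have := cf0 i (~~ b).
  case: (eqVneq (jf i b)) => [<-|_] p1 p2; last first.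
    by rewrite mulr0n mulr0 addr0 => /esym/eqP; rewrite mulf_eq0 signr_eq0 gt_eqF.
  rewrite mulr1n; case: (bf i b); case: (bf i (~~ b));
    by rewrite !(expr0, expr1) => E; first [have : 0 < 0 :> R by lra | split => //; lra];
    rewrite ltxx.
have g0 : 0 < g.
  by have [-> _] := sumE (Ordinal n2) false; rewrite addr_gt0.
(* If the images of two positive vertices shared an axis with opposite signs, one of them would
   agree with the image of a negative vertex. *)
have pi_inj : injective (jf ^~ false).
  move=> i i' ij; case: (eqVneq (bf i false) (bf i' false)) => [bb|bb].
    by have [] := f_inj _ _ _ _ ij bb.
  have [jt bt _] := opp i' false.
  have [] // : i = i' /\ false = true.
  by apply: f_inj; rewrite ?jt ?bt//; move: bb; case: (bf i _); case: (bf i' _).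
have A1 : A *m pt 1 0 = pt (g / 2) 0.
  have -> : pt 1 0 = 2^-1 *: pt 2 0 :> 'cV[R]_(1 + n).
    by rewrite ptZ scaler0 mulVf// pnatr_eq0.
  by rewrite -scalemxAr gh h0 ptZ scaler0 mulrC.
exists (g / 2), (signed_perm_mx (perm pi_inj) (bf ^~ false)); split.
- by rewrite divr_gt0.
- by apply/gen_perm_mxP; exists (perm pi_inj), (bf ^~ false).
have ME (t : R) (x : 'cV[R]_n) (P : 'M[R]_n) :
    (g / 2) *: block_mx 1%:M 0 0 P *m pt t x = (g / 2) *: pt t (P *m x).
  by rewrite -scalemxAl /pt mul_block_col mul1mx !mul0mx addr0 add0r.
apply: mulmx_pt_ext => [|i]; rewrite ME.
  by rewrite A1 mulmx0 ptZ mulr1 scaler0.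
have -> : pt 0 (delta_mx i ord0) = vertex i false + - 1 *: pt 1 0
    :> 'cV[R]_(1 + n).
  by rewrite /vertex expr0 scale1r ptZ ptD scaler0 addr0 mulr1 subrr.
rewrite mulmxDr -scalemxAr A1 AE /vertex !ptZ ptD mulr1 mulr0.
have [_ _ ->] := opp i false; rewrite mulN1r subrr scaler0 addr0; congr pt.
congr (_ *: _); apply/colP => k; rewrite -colE !mxE permE.
by rewrite andbT mulr_natr.
Qed.

End Vertices.

(** * Dual cones and conjugate exponents *)

Section Duality.
Context {R : realType}.

Definition dual_cone {m} (K : set 'cV[R]_m) : set 'cV[R]_m :=
  [set v | forall u, K u -> 0 <= (v^T *m u) ord0 ord0].

Lemma dual_cone_mulmx_tr {m} (K : set 'cV[R]_m) (A : 'M[R]_m) v :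
  (forall v, K v -> K (A *m v)) -> dual_cone K v -> dual_cone K (A^T *m v).
Proof.
by move=> AK Kv u /AK /Kv; rewrite trmx_mul trmxK mulmxA.
Qed.

Context {n : nat}.
Implicit Types (p q s t : R) (x y : 'cV[R]_n).

Lemma pt_dot s t x y :
  ((pt t x)^T *m pt s y) ord0 ord0 = t * s + \sum_i x i ord0 * y i ord0.
Proof.
rewrite /pt tr_col_mx mul_row_col tr_scalar_mx -scalar_mxM mxE mxE eqxx mulr1n.
by congr (_ + _); rewrite mxE; apply: eq_bigr => i _; rewrite mxE.
Qed.

Lemma dual_coneP (K : set 'cV[R]_(1 + n)) t x : dual_cone K (pt t x) <->
  forall s y, K (pt s y) -> 0 <= t * s + \sum_i x i ord0 * y i ord0.
Proof.
split=> [H s y /H|H u]; first by rewrite pt_dot.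
by rewrite [u]pt_eta => /H; rewrite pt_dot.
Qed.

Lemma sum_norm_dot_ge0 a x y : \sum_i `|x i ord0| * `|y i ord0| <= a ->
  0 <= a + \sum_i x i ord0 * y i ord0.
Proof.
move=> H; rewrite -[\sum_i _]opprK subr_ge0 -sumrN.
apply: le_trans H; apply: ler_sum => i _.
by rewrite -normrM -normrN ler_norm.
Qed.

(** Hölder's inequality in cone form: divide by [t] and [s], apply Young's inequality to each term
    and sum. If [t] or [s] is 0, the corresponding vector vanishes. *)
Lemma pcone_pairing p q s t x y : 1 <= p -> 1 <= q -> p^-1 + q^-1 = 1 ->
  pcone q%:E n (pt t x) -> pcone p%:E n (pt s y) ->
  \sum_i `|x i ord0| * `|y i ord0| <= t * s.
Proof.
move=> p1 q1 pq /pcone_ptE-/(_ q1)[t0 Sx] /pcone_ptE-/(_ p1)[s0 Sy].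
have p0 : 0 < p by lra.
have q0 : 0 < q by lra.
have zero (r a : R) (z : 'cV[R]_n) : 0 < r -> 0 <= a -> a == 0 ->
    \sum_i `|z i ord0| `^ r <= a `^ r -> forall i, `|z i ord0| = 0.
  move=> r0 _ /eqP -> + i; rewrite powR0 ?gt_eqF// => S.
  apply/eqP; have : `|z i ord0| `^ r == 0.
    rewrite eq_le powR_ge0 andbT; apply: le_trans S.
    rewrite (bigD1 i)//= lerDl; apply: sumr_ge0 => k _; exact: powR_ge0.
  by rewrite powR_eq0 => /andP[].
case: (eqVneq t 0) => [/eqP tE|tn0].
  rewrite (eqP tE) mul0r big1// => i _; by rewrite (zero q t x q0 t0 tE Sx) mul0r.
case: (eqVneq s 0) => [/eqP sE|sn0].
  rewrite (eqP sE) mulr0 big1// => i _; by rewrite (zero p s y p0 s0 sE Sy) mulr0.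
have tp : 0 < t by rewrite lt_def tn0.
have sp : 0 < s by rewrite lt_def sn0.
have tq : 0 < t `^ q by exact: powR_gt0.
have sq : 0 < s `^ p by exact: powR_gt0.
have term i : `|x i ord0| * `|y i ord0| <= t * s *
    (`|x i ord0| `^ q / t `^ q / q + `|y i ord0| `^ p / s `^ p / p).
  have -> : `|x i ord0| * `|y i ord0| =
      t * s * ((`|x i ord0| / t) * (`|y i ord0| / s)).
    by field; rewrite tn0 sn0.
  apply: ler_wpM2l; first exact: mulr_ge0.
  have X0 : 0 <= `|x i ord0| / t by exact: divr_ge0.
  have Y0 : 0 <= `|y i ord0| / s by exact: divr_ge0.
  have qp : q^-1 + p^-1 = 1 by rewrite addrC.
  have := conjugate_powR X0 Y0 q0 p0 qp.
  have iv (a r : R) : 0 <= a -> a^-1 `^ r = (a `^ r)^-1.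
    move=> a0; rewrite -powR_inv1// -powRrM mulN1r powRN.
    by [].
  by rewrite !powRM ?invr_ge0// !iv.
apply: (le_trans (ler_sum _ (fun i _ => term i))).
rewrite -mulr_sumr -[leRHS]mulr1; apply: ler_wpM2l; first exact: mulr_ge0.
rewrite big_split /= -!mulr_suml -[leRHS]pq addrC.
apply: lerD; rewrite -[leRHS]mul1r; apply: ler_wpM2r;
  rewrite ?invr_ge0 ?(ltW p0) ?(ltW q0)//; by rewrite ler_pdivrMr ?mul1r.
Qed.

(* The extremal vector [y_i = - sgn(x_i) |x_i|^(q-1)] for Hölder's inequality
   detects whether [(t, x)] lies in the dual cone. *)
Lemma dual_pcone p q : 1 < p -> 1 <= q -> p^-1 + q^-1 = 1 ->
  dual_cone (pcone p%:E n) = pcone q%:E n.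
Proof.
move=> p1 q1 pq; have p1' := ltW p1.
apply/seteqP; split=> v; rewrite [v]pt_eta;
  move: (usubmx v ord0 ord0) (dsubmx v) => t x {v}; last first.
  move=> H; apply/dual_coneP => s y Hy; apply: sum_norm_dot_ge0.
  exact: (pcone_pairing p q).
have p0 : 0 < p by lra.
have q0 : 0 < q by lra.
(* This identity turns |y_i|^p into |x_i|^q for the extremal vector. *)
have qp : (q - 1) * p = q.
  have : (p^-1 + q^-1) * (p * q) = p * q by rewrite pq mul1r.
  have -> : (p^-1 + q^-1) * (p * q) = p + q by field; rewrite !gt_eqF.
  by move=> E; rewrite mulrBl mul1r mulrC -E addrAC subrr add0r.
(* Excludes 0^0 = 1, which would spoil |y_i| where x_i = 0. *)
have q1n : q - 1 != 0.
  by apply/eqP => E; move: qp; rewrite E mul0r => q0'; move: q0; rewrite -q0' ltxx.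
move=> /dual_coneP H; apply/pcone_ptE => //.
set S := \sum_i `|x i ord0| `^ q.
have S0 : 0 <= S by apply: sumr_ge0 => i _; exact: powR_ge0.
have t0 : 0 <= t.
  have := H 1 0; rewrite big1; last by move=> i _; rewrite mxE mulr0.
  rewrite mulr1 addr0; apply; apply/pcone_ptE => //; split=> //.
  by rewrite big1 ?powR_ge0// => i _; rewrite mxE normr0 powR0 ?gt_eqF.
split => //; have [->|Sn0] := eqVneq S 0; first exact: powR_ge0.
have Sp : 0 < S by rewrite lt_def Sn0.
pose y : 'cV[R]_n := \col_i (- (Num.sg (x i ord0) * `|x i ord0| `^ (q - 1))).
have yn i : `|y i ord0| = `|x i ord0| `^ (q - 1).
  rewrite mxE normrN normrM normr_sg (ger0_norm (powR_ge0 _ _)).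
  by case: eqVneq => [->|]; rewrite ?mul1r// normr0 powR0// mulr0.
have Ky : pcone p%:E n (pt (S `^ p^-1) y).
  apply/pcone_ptE => //; split; first exact: powR_ge0.
  rewrite -powRrM mulVf ?gt_eqF// powRr1//.
  by under eq_bigr => i _ do rewrite yn -powRrM qp.
have xy : \sum_i x i ord0 * y i ord0 = - S.
  rewrite -sumrN; apply: eq_bigr => i _; rewrite mxE mulrN mulrA.
  by rewrite [x i ord0 * _]mulrC -normrEsg mulr_powRB1.
have := H _ _ Ky; rewrite xy subr_ge0 => St.
(* Divide S <= t S^(1/p) by S^(1/p). *)
have St' : S `^ q^-1 <= t.
  have E : S = S `^ q^-1 * S `^ p^-1.
    by rewrite -powRD ?Sn0 ?implybT// addrC pq powRr1.
  by move: St; rewrite {1}E ler_pM2r// powR_gt0.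
have -> : S = (S `^ q^-1) `^ q by rewrite -powRrM mulVf ?gt_eqF// powRr1.
by apply: ge0_ler_powR => //; rewrite ?nnegrE ?powR_ge0 ?(ltW q0).
Qed.

(** The endpoint case: the bound |y_i| <= s replaces Hölder, and the vector of negated signs of [x]
    is extremal. *)
Lemma dual_pcone_oo : dual_cone (pcone +oo%E n) = pcone (1%:E : \bar R)%E n.
Proof.
apply/seteqP; split=> v; rewrite [v]pt_eta;
  move: (usubmx v ord0 ord0) (dsubmx v) => t x {v}; last first.
  move=> /pcone_ptE-/(_ (lexx _))[t0]; rewrite powRr1// => St.
  apply/dual_coneP => s y /pcone_oo_ptE[s0 ys]; apply: sum_norm_dot_ge0.
  apply: (@le_trans _ _ (\sum_i `|x i ord0| * s)).
    by apply: ler_sum => i _; exact: ler_wpM2l.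
  rewrite -mulr_suml; apply: ler_wpM2r => //; apply: le_trans St.
  by apply: ler_sum => i _; rewrite powRr1.
move=> /dual_coneP H; have t0 : 0 <= t.
  have := H 1 0; rewrite big1; last by move=> i _; rewrite mxE mulr0.
  rewrite mulr1 addr0; apply; apply/pcone_oo_ptE; split=> // i.
  by rewrite mxE normr0.
apply/pcone_ptE => //; split => //; rewrite powRr1//.
have := H 1 (\col_i (- Num.sg (x i ord0))).
have -> : \sum_i x i ord0 * (\col_i (- Num.sg (x i ord0))) i ord0 =
    - \sum_(i < n) `|x i ord0| `^ 1.
  rewrite -sumrN; apply: eq_bigr => i _.
  by rewrite mxE mulrN powRr1// normrEsg mulrC.
rewrite mulr1 subr_ge0; apply; apply/pcone_oo_ptE; split => // i.
by rewrite mxE normrN normr_sg; case: eqP.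
Qed.

End Duality.

(** * Automorphisms of the p-cones *)

Lemma cone_aut_stable {R : realType} {m} (K : set 'cV[R]_m) A :
  cone_aut K A -> [/\ A *m invmx A = 1%:M, invmx A *m A = 1%:M,
    forall v, K v -> K (A *m v) & forall v, K v -> K (invmx A *m v)].
Proof.
move=> [Au AK]; split; [exact: mulmxV|exact: mulVmx| |].
  by move=> v Kv; rewrite -AK; exists v.
by move=> v; rewrite -{1}AK => -[u Ku <-]; rewrite mulmxA mulVmx// mul1mx.
Qed.

(** [B] carries smooth directions at the image of a vertex back to that vertex, where only multiples
    of it are smooth. By [vertexP] the image then lies on a vertex ray. *)
Lemma pcone_stable_form {R : realType} {n} (r : R) (A B : 'M[R]_(1 + n)) :
  1 <= r -> r < 2 -> (2 <= n)%N -> A *m B = 1%:M -> B *m A = 1%:M ->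
  (forall v, pcone r%:E n v -> pcone r%:E n (A *m v)) ->
  (forall v, pcone r%:E n v -> pcone r%:E n (B *m v)) ->
  exists (alpha : R) (P : 'M[R]_n), [/\ 0 < alpha, gen_perm_mx P
    & A = alpha *: block_mx (1%:M : 'M[R]_1) 0 0 P].
Proof.
move=> r1 r2 n2 AB BA AK BK; apply: (vertex_perm_form A B) => // i b.
apply: (vertexP r) => //; first exact: ltW.
- exact: ltnW.
- by apply: AK; exact: pcone_vertex.
- apply/negP => /eqP /(congr1 (mulmx B)).
  rewrite mulmxA BA mul1mx mulmx0 -[RHS](scale0r (vertex i b)) /vertex.
  by rewrite ptZ mul0r => /pt_inj[/eqP]; rewrite oner_eq0.
- move=> w /(smooth_dir_mulmx _ _ _ _ BK).
  rewrite mulmxA BA mul1mx => /(vertex_smooth_dir _ _ _ _ r1 r2)[l wE].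
  by exists l; rewrite scalemxAr -wE mulmxA AB mul1mx.
Qed.

Lemma cone_aut_pcone_form {R : realType} (p : \bar R) n (A : 'M[R]_(1 + n)) :
  (1%:E <= p)%E -> p <> 2%:E -> (2 <= n)%N -> cone_aut (pcone p n) A ->
  exists (alpha : R) (P : 'M[R]_n), [/\ 0 < alpha, gen_perm_mx P
    & A = alpha *: block_mx (1%:M : 'M[R]_1) 0 0 P].
Proof.
move=> p1 p2 n2 /cone_aut_stable[AB BA AK BK].
(* Either the exponent is below 2 or the dual cone has such an exponent: r / (r - 1) for finite r >
   2, and 1 for the infinite exponent. *)
have [[r [r1 r2 pE]]|[q [q1 q2 dualE]]] : (exists r : R, [/\ 1 <= r, r < 2 & p = r%:E]) \/
    exists q : R, [/\ 1 <= q, q < 2 & dual_cone (pcone p n) = pcone q%:E n].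
- case: p p1 p2 {AK BK} => [r| |] // p1 p2; last first.
    by right; exists 1; split=> //; [lra|exact: dual_pcone_oo].
  move: p1; rewrite lee_fin => r1; case: (ltgtP r 2) => [r2|r2|r2].
  + by left; exists r.
  + have r10 : 0 < r - 1 by lra.
    have q1 : 1 <= r / (r - 1) by rewrite ler_pdivlMr; lra.
    right; exists (r / (r - 1)); split=> //; first by rewrite ltr_pdivrMr; lra.
    by apply: dual_pcone => //; [lra|field; rewrite !gt_eqF//; lra].
  + by case: p2; rewrite r2.
- by rewrite pE in AK BK; exact: (pcone_stable_form r A (invmx A)).
have AK' v : pcone q%:E n v -> pcone q%:E n (A^T *m v).
  by rewrite -dualE; exact: dual_cone_mulmx_tr.
have BK' v : pcone q%:E n v -> pcone q%:E n ((invmx A)^T *m v).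
  by rewrite -dualE; exact: dual_cone_mulmx_tr.
have [||a [P [a0 gP AE]]] := pcone_stable_form _ _ _ q1 q2 n2 _ _ AK' BK'.
- by rewrite -trmx_mul BA trmx1.
- by rewrite -trmx_mul AB trmx1.
exists a, P^T; split=> //; first exact: gen_perm_mx_tr.
by rewrite -[A]trmxK AE linearZ /= tr_block_mx trmx1 !trmx0.
Qed.

Theorem corollary12 (R : realType) (p : \bar R) (n : nat)
    (p_ge1 : (1%:E <= p)%E) (p_neq2 : (p <> 2%:E)%E) (n_ge2 : (2 <= n)%N) :
  cone_aut (pcone p n) = cone_aut (pcone (1%:E : \bar R)%E n) /\
  (forall A : 'M[R]_(1 + n), cone_aut (pcone p n) A ->
     exists (alpha : R) (P : 'M[R]_n),
       [/\ 0 < alpha, gen_perm_mx P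
         & A = alpha *: block_mx (1%:M : 'M[R]_1) 0 0 P]).
Proof.
split; last by move=> A; exact: cone_aut_pcone_form.
have one_neq2 : (1%:E : \bar R) <> 2%:E.
  by move=> -[] /eqP; rewrite -[1]/(1%:R) eqr_nat.
(* Both inclusions go through the block form, which preserves the cone for every exponent. *)
apply/seteqP; split=> A /cone_aut_pcone_form[]// a [P [a0 gP ->]];
  exact: cone_aut_signed_perm.
Qed.
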